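(* Let $n\ge 1$ and let $X$ be a finite pure $n$-dimensional simplicial complex with connected links, equipped with the homogeneous weight function $m$. Assume that $X$ is $K$-regular in the following sense: every vertex $\{v\}\in X(0)$ is contained in exactly $K$ $n$-dimensional simplices of $X$, i.e. $m(\{v\})=n!\,K$. Assume that there is a constant $0<\lambda<1$ such that for every $0\le k\le n-1$ and every $\tau\in X(k-1)$, $\mathrm{Spec}((M')^+_{\tau,0})\subseteq[-\lambda,\lambda]\cup\{1\}$. Then $$\mathrm{overlap}(X)\ge n!\,\mathcal{P}_n\left(\left(\frac{\mathcal{P}_n}{n+1}\right)^n-(n+1)C_n\lambda\right),$$ where $\mathcal{P}_n$ is the constant of Pach's theorem and $$C_n=\sum_{k=0}^{n-1}\left((k+1)(k+2)^{n-k}-(k+1)^{n-k+1}\right).$$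
   Context: $X(k)$ denotes the set of simplices of $X$ with $k+1$ vertices, $X(-1)=\{\emptyset\}$; a vertex $v$ is identified with $\{v\}\in X(0)$. $X$ is pure $n$-dimensional if every simplex is contained in a simplex of $X(n)$. For $\tau\in X(k)$ the link $X_\tau$ is the complex with $\eta\in X_\tau(l)$ iff $\eta\in X(l)$ and $\tau\cup\eta\in X(k+l+1)$; $X_\emptyset=X$. ''Connected links'' means that for every $-1\le k\le n-2$ and every $\tau\in X(k)$ the one-skeleton of $X_\tau$ (the graph with vertices $X_\tau(0)$ and edges $X_\tau(1)$) is connected; in particular the one-skeleton of $X$ is connected. Homogeneous weight: for $-1\le k\le n$ and $\tau\in X(k)$, $m(\tau)=(n-k)!\,|\{\sigma\in X(n):\tau\subseteq\sigma\}|$. On the link, $m_\tau(\eta)=m(\tau\cup\eta)$. The weighted random walk operator $(M')^+_{\tau,0}$ acts on functions $\phi:X_\tau(0)\to\mathbb{R}$ by $$(M')^+_{\tau,0}\phi(v)=\sum_{u:\{u,v\}\in X_\tau(1)}\frac{m_\tau(\{u,v\})}{m_\tau(\{v\})}\phi(u).$$ Overlap: $$\mathrm{overlap}(X)=\min_{f:X(0)\to\mathbb{R}^n}\max_{x\in\mathbb{R}^n}\frac{|\{\{v_0,\dots,v_n\}\in X(n):x\in\mathrm{conv}\{f(v_0),\dots,f(v_n)\}\}|}{|X(n)|},$$ the minimum being over all maps $f$, and $\mathrm{conv}$ denoting convex hull. Pach's theorem (known): for every $n$ there is a constant $\mathcal{P}_n>0$ such that for any finite sets $S_0,\dots,S_n$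 of points in $\mathbb{R}^n$ there are subsets $U_0\subseteq S_0,\dots,U_n\subseteq S_n$ with $|U_i|\ge\mathcal{P}_n|S_i|$ for every $0\le i\le n$ and $\bigcap_{x_0\in U_0,\dots,x_n\in U_n}\mathrm{conv}\{x_0,\dots,x_n\}\ne\emptyset$. $\mathcal{P}_n$ denotes such a constant. *)

(* Defs.v *)
From HB Require Import structures.
From mathcomp Require Import all_boot all_order all_algebra finmap.
From mathcomp Require Import boolp classical_sets reals convex.

Set Implicit Arguments.
Unset Strict Implicit.
Unset Printing Implicit Defensive.

Import Order.TTheory GRing.Theory Num.Theory.
Local Open Scope ring_scope.

Section Complex.
Variable V : finType.
Implicit Types (X : {set {set V}}) (s t : {set V}).

(* The empty simplex belongs to every complex, so X(-1) = {set0}. *)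
Definition simplicial_complex X :=
  finset.set0 \in X /\ forall s t, s \in X -> t \subset s -> t \in X.

(* Simplices are indexed by their number of vertices:
   X(k) is faces X k.+1, and X(-1) is faces X 0. *)
Definition faces X (j : nat) : {set {set V}} := [set s in X | #|s| == j].

Definition pure X (n : nat) :=
  forall s, s \in X -> exists2 t, t \in faces X n.+1 & s \subset t.

(* The cardinality condition makes s and t disjoint. *)
Definition link X t : {set {set V}} :=
  [set s in X | t :|: s \in faces X (#|t| + #|s|)].

(* Elements of V that are not in X(0) are allowed; they play no role. *)
Definition vertex X := {v : V | [set v] \in X}.

Definition edge X : rel (vertex X) :=
  [rel u v | [set val u; val v] \in faces X 2].

Definition connected_skeleton X := forall u v, connect (@edge X) u v.

(* The bound #|t| < n says that t has dimension at most n - 2. *)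
Definition connected_links X (n : nat) :=
  forall t, t \in X -> (#|t| < n)%N -> connected_skeleton (link X t).

(* If t is in X(k), then n - k = n.+1 - #|t|. *)
Definition weight X (n : nat) t : nat :=
  ((n.+1 - #|t|)`! * #|[set s in faces X n.+1 | t \subset s]|)%N.

Definition regular X (n K : nat) :=
  forall v : vertex X, #|[set s in faces X n.+1 | val v \in s]| = K.

End Complex.

Section Walk.
Variables (R : realType) (V : finType) (X : {set {set V}}) (n : nat).
Variable t : {set V}.

Definition link_weight (s : {set V}) : R := (weight X n (t :|: s))%:R.

Definition walk (phi : {ffun vertex (link X t) -> R^o}) :
    {ffun vertex (link X t) -> R^o} :=
  [ffun v => \sum_(u | edge u v)
     link_weight [set val u; val v] / link_weight [set val v] * phi u].

Fact walk_is_linear : linear walk.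
Proof.
move=> a phi psi; apply/ffunP => v; rewrite !ffunE scaler_sumr -big_split /=.
by apply: eq_bigr => u _; rewrite !ffunE mulrDr /GRing.scale /= mulrCA.
Qed.

HB.instance Definition _ := GRing.isLinear.Build R _ _ _ walk walk_is_linear.

(* The operator is self-adjoint for the inner product weighted by m_t, so
   its spectrum is its set of real eigenvalues. *)
Definition walk_spectrum : set R := [set a | passmx.leigenvalue (linfun walk) a]%classic.

End Walk.

Arguments walk_spectrum R {V} X n t.

Section Overlap.
Variables (R : realType) (n : nat).

Definition conv_hull (A : set 'rV[R]_n) : set 'rV[R]_n :=
  smallest (@convex_set R 'rV[R]_n) A.

Definition overlap_at (V : finType) (X : {set {set V}})
    (f : vertex X -> 'rV[R]_n) (x : 'rV[R]_n) : R :=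
  #|[set s in faces X n.+1 |
      `[< conv_hull [set f v | v in [set v | val v \in s]]%classic x >]]|%:R
  / #|faces X n.+1|%:R.

(* overlap_at takes finitely many values, so the infimum and the suprema are
   attained, as overlap_max and overlap_min show. *)
Definition overlap (V : finType) (X : {set {set V}}) : R :=
  inf (range (fun f : vertex X -> 'rV[R]_n => sup (range (overlap_at f)))).

(* The finite sets S i need not be disjoint or nonempty. *)
Definition pach_constant (P : R) :=
  0 < P /\
  forall S : 'I_n.+1 -> {fset 'rV[R]_n},
  exists U : 'I_n.+1 -> {fset 'rV[R]_n},
    (forall i, (U i `<=` S i)%fset /\ P * #|` S i|%:R <= #|` U i|%:R) /\
    exists y, forall x : 'I_n.+1 -> 'rV[R]_n,
      (forall i, x i \in U i) -> conv_hull (range x) y.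

Definition mixing_constant : R :=
  \sum_(0 <= k < n) (k.+1%:R * k.+2%:R ^+ (n - k) - k.+1%:R ^+ (n - k).+1).

End Overlap.

Section Attained.
Local Open Scope classical_set_scope.
Variables (R : realType) (T : Type) (x0 : T) (N : nat) (c : R) (g : T -> nat).
Hypotheses (c_ge0 : 0 <= c) (gN : forall x, (g x <= N)%N).
Let h x : R := (g x)%:R / c.

Let le_h x y : (g x <= g y)%N -> h x <= h y.
Proof. by move=> le; rewrite ler_wpM2r ?invr_ge0 ?ler_nat. Qed.

Fact sup_ratio : exists x, sup (range h) = h x.
Proof.
have ex : exists m, `[< exists x, g x = m >] by exists (g x0); apply/asboolP; exists x0.
have bd m : `[< exists x, g x = m >] -> (m <= N)%N by case/asboolP=> x <-.
case: (ex_maxnP ex bd) => m /asboolP[x gx] maxm; exists x.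
have ub : ubound (range h) (h x).
  by move=> _ [y _ <-]; apply: le_h; rewrite gx; apply: maxm; apply/asboolP; exists y.
apply/eqP; rewrite eq_le ge_sup //=; last by exists (h x); exists x.
by apply: ub_le_sup; [exists (h x) | exists x].
Qed.

Fact inf_ratio : exists x, inf (range h) = h x.
Proof.
have ex : exists m, `[< exists x, g x = m >] by exists (g x0); apply/asboolP; exists x0.
case: (ex_minnP ex) => m /asboolP[x gx] minm; exists x.
have lb : lbound (range h) (h x).
  by move=> _ [y _ <-]; apply: le_h; rewrite gx; apply: minm; apply/asboolP; exists y.
apply/eqP; rewrite eq_le lb_le_inf //=; last by exists (h x); exists x.
by rewrite andbT; apply: ge_inf; [exists (h x) | exists x].
Qed.

End Attained.

Section OverlapAttained.
Variables (R : realType) (n : nat) (V : finType) (X : {set {set V}}).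

Let cover (f : vertex X -> 'rV[R]_n) (x : 'rV[R]_n) : nat :=
  #|[set s in faces X n.+1 |
      `[< conv_hull [set f v | v in [set v | val v \in s]]%classic x >]]|.

Let cover_le f x : (cover f x <= #|faces X n.+1|)%N.
Proof. by apply: subset_leq_card; apply/fintype.subsetP => s; rewrite inE => /andP[]. Qed.

Lemma overlap_max (f : vertex X -> 'rV[R]_n) :
  exists x, sup (range (overlap_at f)) = overlap_at f x.
Proof. exact: (sup_ratio 0 (ler0n R _) (cover_le f)). Qed.

Lemma overlap_min :
  exists f : vertex X -> 'rV[R]_n, overlap R n X = sup (range (overlap_at f)).
Proof.
pose x f := sval (cid (@overlap_max f)).
have E : (fun f => sup (range (@overlap_at R n V X f))) =
    (fun f => (cover f (x f))%:R / #|faces X n.+1|%:R).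
  by apply/funext => f; rewrite /x; case: cid.
have [f eqf] := inf_ratio (fun=> 0 : 'rV[R]_n) (fun f => cover f (x f))
  (ler0n R #|faces X n.+1|).
by exists f; rewrite /overlap E eqf; exact: (esym (congr1 (@^~ f) E)).
Qed.

End OverlapAttained.

(* Main.v *)
Require Import Defs.
From HB Require Import structures.
From mathcomp Require Import all_boot all_order all_algebra finmap.
From mathcomp Require Import spectral complex sesquilinear interval_inference.
From mathcomp Require Import boolp classical_sets set_interval reals convex.
From mathcomp Require Import topology normedtype derive.
(* Again, so that their names are not shadowed by those of classical_sets. *)
From mathcomp Require Import fintype finset.
From mathcomp Require Import ring lra zify.
Set Implicit Arguments.
Unset Strict Implicit.
Unset Printing Implicit Defensive.
Import Order.TTheory GRing.Theory Num.Theory.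
Import numFieldNormedType.Exports.
Local Open Scope ring_scope.

(* Split the N vertices into n + 1 disjoint blocks of the same size; Pach's
   theorem yields U_0, ..., U_n, which we shrink to a common size u, and a
   point in the convex hull of the image of every transversal.  It remains to
   bound from below the number of n-simplices with one vertex in each U_i.

   Let W(t; U_0, ..., U_d) count the tuples (v_0, ..., v_d) of the product of
   the U_i that complete the simplex t to an n-simplex, and let a_t(U) be the
   proportion of U among the vertices of the link of t, weighted by m_t.  Then
     |W(t; U_0, ..., U_d) - m(t) a_t(U_0) ... a_t(U_d)|
       <= lam (d / 2) m(t) (a_t(U_0) + ... + a_t(U_d)).
   Indeed W(t; U_0, ..., U_d) is the sum over v in U_0 of
   W(t + v; U_1, ..., U_d).  By induction the latter is about m(t + v) times the
   product of the a_(t + v)(U_i), and a_(t + v)(U_i) is the value at v of the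
   walk operator of the link of t on the indicator of U_i; the spectral gap
   allows us to replace these factors by a_t(U_i) one at a time.

   At t = empty the error is lam (n (n + 1) / 2) (u / N) m(empty), and
   n (n + 1) / 2 <= C_n.  The remaining factor n + 1 in front of C_n lam pays
   for rounding N / (n + 1) down, as lam >= 1 / N. *)

(** * Quadratic forms of real symmetric matrices *)

Section SymmetricMatrix.
Local Open Scope sesquilinear_scope.

(** Over [R[i]] the matrix is hermitian, hence unitarily diagonalizable with real spectrum. A
    unitary change of variables preserves the sum of squares and turns the form into a sum of
    eigenvalues times squares. *)
Lemma sym_quadratic_bound (R : rcfType) (n : nat) (S : 'M[R]_n) (lam : R) :
  S^T = S -> (forall a, eigenvalue S a -> `|a| <= lam) ->
  forall x : 'rV_n, `|(x *m S *m x^T) 0 0| <= lam * \sum_i x 0 i ^+ 2.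
Proof.
move=> symS specS x; pose toC : {rmorphism R -> R[i]} := real_complex R.
have realC r : toC r \is Num.real by rewrite complex_real.
have normC r : `|toC r| = toC `|r|.
  by rewrite normc_def /= expr0n addr0 sqrtr_sqr.
have leC r s : (toC r <= toC s) = (r <= s) by rewrite lecR.
pose A := map_mx toC S; pose P := spectralmx A; pose d := spectral_diag A.
have hermA : A \is hermsymmx.
  apply: realsym_hermsym; last by apply/mxOverP => i j; rewrite mxE.
  by apply/is_hermitianmxP; rewrite expr0 scale1r map_mx_id // map_trmx symS.
have realL := mxOverP (hermitian_spectral_diag_real hermA).
have /hermitian_normalmx/orthomx_spectralP defA := hermA.
have unitP : P \is unitarymx by apply: spectral_unitarymx.
have bound_d i : `|d 0 i| <= toC lam.
  have /complex_realP[r dr] := realL 0 i.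
  rewrite /d dr [X in `|X|](_ : _ = toC r) // normC leC specS //.
  (* Being a root of the characteristic polynomial descends from [R[i]] to [R]. Over [R[i]], row [i]
     of [P] is an eigenvector. *)
  rewrite eigenvalue_root_char -(fmorph_root toC) map_char_poly.
  rewrite -eigenvalue_root_char; apply/eigenvalueP; exists (row i P).
    rewrite -/A defA -/P !mulmxA -row_mul mulmxV ?unitarymx_unit // row1.
    rewrite -rowE row_diag_mx -scalemxAl -rowE dr //.
  apply: contraTneq (unitarymx_unit unitP) => Pi0.
  rewrite -row_free_unit -kermx_eq0; apply/eqP => kP.
  have: delta_mx 0 i *m P = 0 :> 'rV_n by rewrite -rowE.
  move/sub_kermxP; rewrite kP submx0 => /eqP/rowP/(_ i)/eqP.
  by rewrite !mxE !eqxx oner_eq0.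
pose y := map_mx toC x; pose z := y *m P^t*.
have yC : y^t* = map_mx toC x^T.
  by apply/matrixP => i j; rewrite !mxE conj_Creal.
have zC : z^t* = P *m y^t* by rewrite /z trmx_mul map_mxM trmxCK.
have QE : toC ((x *m S *m x^T) 0 0) = \sum_i d 0 i * `|z 0 i| ^+ 2.
  transitivity ((z *m diag_mx d *m z^t*) 0 0).
    have -> : z *m diag_mx d *m z^t* = map_mx toC (x *m S *m x^T).
      by rewrite !map_mxM -/A defA zC yC invmx_unitary // !mulmxA.
    by rewrite [RHS]mxE.
  rewrite mul_mx_diag mxE; apply: eq_bigr => i _; rewrite !mxE normCK; ring.
have NE : toC (\sum_i x 0 i ^+ 2) = \sum_i `|z 0 i| ^+ 2.
  transitivity ((z *m z^t*) 0 0); last first.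
    by rewrite mxE; apply: eq_bigr => i _; rewrite !mxE normCK.
  rewrite zC mulmxA mulmxKtV // mxE rmorph_sum; apply: eq_bigr => i _ /=.
  by rewrite rmorphXn /= !mxE conj_Creal // expr2.
rewrite -leC -normC QE rmorphM NE mulr_sumr.
apply: le_trans (ler_norm_sum _ _ _) (ler_sum _ _) => i _.
by rewrite normrM normrX normr_id ler_wpM2r ?exprn_ge0.
Qed.

End SymmetricMatrix.

(** * Spectral gap of a reversible Markov kernel *)

Section ReversibleKernel.
Variables (R : rcfType) (T : finType) (w : T -> R) (k : T -> T -> R) (lam : R).
Hypothesis w_gt0 : forall v, 0 < w v.
Hypothesis k_ge0 : forall u v, 0 <= k u v.
Hypothesis k_sym : forall u v, k u v = k v u.
Hypothesis k_sum : forall v, \sum_u k u v = w v.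
(** Connectedness of the graph of positive entries of [k], phrased through functions that are
    constant along edges. *)
Hypothesis k_conn : forall phi : T -> R,
  (forall u v, 0 < k u v -> phi u = phi v) -> forall u v, phi u = phi v.
Hypothesis k_spec : forall a (phi : T -> R), (exists v, phi v != 0) ->
  (forall v, \sum_u k u v * phi u = a * (w v * phi v)) -> `|a| <= lam \/ a = 1.

(** The Dirichlet energy of a harmonic function vanishes, and its terms are nonnegative, so [phi]
    does not vary along edges of positive weight. *)
Lemma harmonic_const (phi : T -> R) :
  (forall v, \sum_u k u v * phi u = w v * phi v) -> forall u v, phi u = phi v.
Proof.
move=> harm; apply: k_conn => u v kuv.
have energy : \sum_v \sum_u k u v * (phi u - phi v) ^+ 2 = 0.
  transitivity (\sum_v \sum_u (k u v * phi u ^+ 2)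
    - (\sum_v (2 * phi v * \sum_u k u v * phi u)
      - \sum_v (\sum_u k u v) * phi v ^+ 2)).
    rewrite -!sumrB; apply: eq_bigr => y _.
    rewrite mulr_sumr mulr_suml -!sumrB; apply: eq_bigr => x _; ring.
  rewrite exchange_big /=.
  under eq_bigr do rewrite -mulr_suml.
  rewrite -!sumrB big1 // => x _; rewrite harm k_sum.
  rewrite (eq_bigr (fun j => k j x)) ?k_sum; last by move=> j _; apply: k_sym.
  ring.
have pos x y : 0 <= k x y * (phi x - phi y) ^+ 2 by rewrite mulr_ge0 ?sqr_ge0.
have /psumr_eq0P/(_ v isT) e1 : \sum_v \sum_u k u v * (phi u - phi v) ^+ 2 = 0.
  by [].
have {}/psumr_eq0P/(_ u isT)/eqP : \sum_u k u v * (phi u - phi v) ^+ 2 = 0.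
  by apply: e1 => y _; apply: sumr_ge0.
by rewrite mulf_eq0 gt_eqF //= sqrf_eq0 subr_eq0 => /(_ (fun x _ => pos x v))/eqP.
Qed.

Let Z := \sum_v w v.

(* The walk operator, symmetrized and deflated along the constant functions. *)
Let S : 'M[R]_#|T| := \matrix_(i, j)
  (k (enum_val i) (enum_val j) / Num.sqrt (w (enum_val i) * w (enum_val j))
   - Num.sqrt (w (enum_val i) * w (enum_val j)) / Z).

(** The factor sqrt(w) turns the inner product weighted by [w] into the standard one. *)
Let vec (phi : T -> R) : 'rV[R]_#|T| :=
  \row_i (Num.sqrt (w (enum_val i)) * phi (enum_val i)).

Let sum_enum (F : T -> R) : \sum_(i < #|T|) F (enum_val i) = \sum_v F v.
Proof. by rewrite [RHS](reindex _ (onW_bij _ (@enum_val_bij T))). Qed.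

Let sqrt_gt0 v : 0 < Num.sqrt (w v). Proof. by rewrite sqrtr_gt0. Qed.
Let sqrtD v : Num.sqrt (w v) != 0. Proof. by rewrite gt_eqF. Qed.
Let sqrtK v : Num.sqrt (w v) * Num.sqrt (w v) = w v.
Proof. by rewrite -expr2 sqr_sqrtr // ltW. Qed.

Let mulS (phi : T -> R) i : (vec phi *m S) 0 i =
  ((\sum_u k u (enum_val i) * phi u) / w (enum_val i)
   - (\sum_u w u * phi u) / Z) * Num.sqrt (w (enum_val i)).
Proof.
rewrite mxE -sum_enum -(sum_enum (fun u => w u * phi u)) !mulr_suml -sumrB.
rewrite mulr_suml; apply: eq_bigr => j _; rewrite !mxE sqrtrM ?ltW //.
move: (sqrtK (enum_val i)) (sqrtK (enum_val j)).
move: (sqrtD (enum_val i)) (sqrtD (enum_val j)) (Z^-1).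
move: (Num.sqrt (w (enum_val i))) (Num.sqrt (w (enum_val j))) => a b.
by move=> a0 b0 z <- <-; field; rewrite a0 b0.
Qed.

Let symS : S^T = S.
Proof. by apply/matrixP => i j; rewrite !mxE k_sym (mulrC (w (enum_val i))). Qed.

Let stationary (phi : T -> R) :
  \sum_v \sum_u k u v * phi u = \sum_u w u * phi u.
Proof.
rewrite exchange_big /=; apply: eq_bigr => u _; rewrite -mulr_suml.
by rewrite -k_sum; congr (_ * _); apply: eq_bigr => v _; apply: k_sym.
Qed.

Hypothesis lam_ge0 : 0 <= lam.

(** Undoing the symmetrization, an eigenvector becomes [phi] with walk(phi) = a phi + c, where [c]
    is the mean of [phi]. Summing against [w] gives a c = 0. If c = 0, then [phi] is an
    eigenfunction of the walk itself, and a = 1 would make it constant of mean zero, hence zero. *)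
Let specS a : eigenvalue S a -> `|a| <= lam.
Proof.
case/eigenvalueP => x xS x0.
pose phi v := x 0 (enum_rank v) / Num.sqrt (w v).
have xE : x = vec phi.
  by apply/rowP => i; rewrite mxE /phi enum_valK mulrCA mulfV ?mulr1.
have [i xi] : exists i, x 0 i != 0.
  apply/existsP; apply: contraNT x0; rewrite negb_exists => /forallP x0.
  by apply/eqP/rowP => i; rewrite mxE; apply/eqP; move: (x0 i); rewrite negbK.
have Z_gt0 : 0 < Z.
  apply: (lt_le_trans (w_gt0 (enum_val i))).
  rewrite /Z (bigD1 (enum_val i)) //= lerDl.
  by apply: sumr_ge0 => v _; apply: ltW.
pose c := (\sum_u w u * phi u) / Z.
have eig v : \sum_u k u v * phi u = (a * phi v + c) * w v.
  have := congr1 (fun y : 'rV_ _ => y 0 (enum_rank v)) xS.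
  rewrite {1}xE mulS -/c mxE enum_rankK xE mxE enum_rankK => e.
  have {}e : (\sum_u k u v * phi u) / w v = a * phi v + c.
    apply: (mulIf (sqrtD v)); rewrite -[LHS](subrK (c * Num.sqrt (w v))) -mulrBl e.
    by ring.
  by rewrite -e mulfVK // gt_eqF.
have phiN0 : exists v, phi v != 0.
  exists (enum_val i); rewrite /phi enum_valK mulf_neq0 ?invr_eq0 //.
have : a * c = 0.
  have := stationary phi; under eq_bigr do rewrite eig mulrDl.
  rewrite big_split /= -mulr_sumr -/Z /c mulfVK ?gt_eqF // -[RHS]add0r => /addIr e.
  rewrite /c mulrA -[RHS](mul0r Z^-1) -[X in _ = X / _]e mulr_sumr; congr (_ / _).
  by apply: eq_bigr => v _; ring.
move/eqP; rewrite mulf_eq0 => /orP[/eqP ->|/eqP c0]; first by rewrite normr0.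
have eig0 v : \sum_u k u v * phi u = a * (w v * phi v).
  by rewrite eig c0; ring.
case: (k_spec phiN0 eig0) => // a1.
have const := @harmonic_const phi _.
have {}const v : phi v = phi (enum_val i).
  by apply: const => u; rewrite eig0 a1 mul1r.
move: c0; rewrite /c; under eq_bigr do rewrite const.
rewrite -mulr_suml -/Z mulrAC mulfV ?gt_eqF // mul1r => phi0.
by case: phiN0 => v; rewrite const phi0 eqxx.
Qed.

(** As [g] has mean zero, deflation does not change the bilinear form. Polarization writes four
    times the form as Q(h + g) - Q(h - g); the quadratic bound and the parallelogram law finish. *)
Lemma kernel_spectral_gap (h g : T -> R) : \sum_v w v * g v = 0 ->
  `|\sum_v \sum_u k u v * h v * g u|
    <= lam / 2 * \sum_v w v * (h v ^+ 2 + g v ^+ 2).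
Proof.
move=> g0; pose Q (x : 'rV_#|T|) := (x *m S *m x^T) 0 0.
have bil : \sum_v \sum_u k u v * h v * g u = (vec g *m S *m (vec h)^T) 0 0.
  rewrite mxE -sum_enum; apply: eq_bigr => i _; rewrite mulS g0 mul0r subr0.
  rewrite !mxE mulrA -[_ * _ * Num.sqrt _]mulrA sqrtK mulfVK ?gt_eqF //.
  by rewrite mulr_suml; apply: eq_bigr => u _; ring.
have symB : (vec h *m S *m (vec g)^T) 0 0 = (vec g *m S *m (vec h)^T) 0 0.
  have tr00 (A : 'M[R]_1) : A 0 0 = A^T 0 0 by rewrite mxE.
  by rewrite tr00 !trmx_mul !trmxK symS mulmxA.
have polar : 4 * (vec g *m S *m (vec h)^T) 0 0 =
    Q (vec h + vec g) - Q (vec h - vec g).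
  rewrite /Q linearD linearB /= !(mulmxDl, mulmxDr, mulNmx, mulmxN).
  move: symB; move: (vec h *m S) (vec g *m S) => a b.
  move: (a *m _) (b *m _) (a *m _) (b *m _) => c1 c2 c3 c4.
  by rewrite !mxE => ->; ring.
have normE e : \sum_i (vec h + e *: vec g) 0 i ^+ 2 =
    \sum_v w v * (h v + e * g v) ^+ 2.
  rewrite -sum_enum; apply: eq_bigr => i _; rewrite !mxE.
  by have := sqrtK (enum_val i); move: (Num.sqrt _) => a <-; ring.
have /ler_normlP[b1 b2] := sym_quadratic_bound symS specS (vec h + 1 *: vec g).
have /ler_normlP[b3 b4] := sym_quadratic_bound symS specS (vec h + -1 *: vec g).
have par : \sum_v w v * (h v + 1 * g v) ^+ 2 + \sum_v w v * (h v + -1 * g v) ^+ 2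
    = 2 * \sum_v w v * (h v ^+ 2 + g v ^+ 2).
  by rewrite mulr_sumr -big_split; apply: eq_bigr => v _ /=; ring.
have {}par := congr1 (fun x => lam * x) par; rewrite mulrDr in par.
rewrite bil; move: b1 b2 b3 b4 par; rewrite !normE !scaleN1r !scale1r -!/(Q _).
move: (\sum_v _) (\sum_v _) (\sum_v _) => s1 s2 s3 b1 b2 b3 b4 par.
apply/ler_normlP; split; lra.
Qed.

End ReversibleKernel.

(** * The spectral gap of the walk on a link *)

Definition simplex_mass (R : realType) (V : finType) (X : {set {set V}}) (n : nat)
  (s : {set V}) : R := (weight X n s)%:R.

(* The walk on the link of t contracts mean-zero functions g by lam; the
   bilinear bound is given in the form in which AM-GM has been applied, which
   loses nothing when all the sets to be mixed have the same size. *)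
Definition walk_gap (R : realType) (V : finType) (X : {set {set V}}) (n : nat)
    (lam : R) (t : {set V}) :=
  let m := simplex_mass R X n in
  forall h g : V -> R, \sum_(v | v \notin t) m (v |: t) * g v = 0 ->
  `|\sum_(v | v \notin t) h v *
      \sum_(u | u \notin v |: t) m (u |: (v |: t)) * g u|
   <= lam / 2 * \sum_(v | v \notin t) m (v |: t) * (h v ^+ 2 + g v ^+ 2).

Section Link.
Variables (R : realType) (V : finType) (X : {set {set V}}) (n : nat).
Hypothesis complexX : simplicial_complex X.
Hypothesis pureX : pure X n.

Local Notation m := (simplex_mass R X n).

Lemma weight_facet (s : {set V}) : s \in faces X n.+1 -> weight X n s = 1%N.
Proof.
move=> Xs; have [_ cs] : s \in X /\ #|s| = n.+1.
  by move: Xs; rewrite inE => /andP[? /eqP].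
rewrite /weight cs subnn mul1n (_ : [set _ in _ | _] = [set s]) ?cards1 //.
apply/setP => t; rewrite !inE; apply/idP/eqP => [|->]; last first.
  by rewrite subxx andbT; move: Xs; rewrite inE.
case/andP=> /andP[_ /eqP ct] st; apply/esym/eqP.
by rewrite eqEcard st ct cs leqnn.
Qed.

Lemma weight_gt0 (s : {set V}) : s \in X -> (0 < weight X n s)%N.
Proof.
move=> /pureX[t Xt st]; rewrite muln_gt0 fact_gt0 /=.
by apply/card_gt0P; exists t; rewrite inE Xt.
Qed.

Lemma weight_eq0 (s : {set V}) : s \notin X -> weight X n s = 0%N.
Proof.
move=> Xs; apply/eqP; rewrite muln_eq0 orbC cards_eq0; apply/orP; left.
apply/eqP/setP => t; rewrite !inE; apply: contraNF Xs.
by case/andP=> /andP[Xt _] /(complexX.2 _ _ Xt).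
Qed.

(** Count pairs of a facet containing [s] and a vertex of it outside [s]: each facet occurs
    [n.+1 - #|s|] times, which is the ratio of the two factorials. *)
Lemma sum_weight (s : {set V}) : (#|s| <= n)%N ->
  (\sum_(v | v \notin s) weight X n (v |: s) = weight X n s)%N.
Proof.
move=> sn; rewrite /weight subSn // factS.
set F := faces X n.+1.
rewrite (eq_bigr (fun v => (n - #|s|)`! * \sum_(t in F | v |: s \subset t) 1))%N.
  rewrite -big_distrr /= mulnAC mulnC; congr (_ * _)%N.
  rewrite (exchange_big_dep [pred t | (t \in F) && (s \subset t)]) /=; last first.
    by move=> v t _ /andP[-> /(fintype.subset_trans (finset.subsetU1 v s)) ->].
  rewrite (eq_bigr (fun=> n.+1 - #|s|)%N) => [|t /andP[Ft st]].
    by rewrite sum_nat_cond_const subSn // mulnC.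
  have /andP[_ /eqP ct] : (t \in X) && (#|t| == n.+1) by move: Ft; rewrite inE.
  rewrite -ct -(cardsDS st) sum1dep_card; apply: eq_card => v.
  by rewrite finset.in_setD finset.in_set Ft finset.subUset sub1set st andbT.
move=> v sv; rewrite cardsU1 sv add1n subSS; congr (_ * _)%N.
by rewrite sum1dep_card; apply: eq_card => t; rewrite !inE.
Qed.

Lemma vertex_link (t : {set V}) v : ([set v] \in link X t) = (v \notin t) && (v |: t \in X).
Proof.
rewrite !inE cards1 addn1 [t :|: _]finset.setUC cardsU1.
have [tv|tv] /= := boolP (v \in t).
  by rewrite add0n [_ == _](_ : _ = false) ?andbF //; apply/negbTE; lia.
rewrite add1n eqxx andbT; apply/andP/idP => [[]|] // Xvt; split=> //.
by apply: complexX.2 Xvt (finset.subsetUl _ _).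
Qed.

Lemma edge_link (t : {set V}) (u v : vertex (link X t)) :
  edge u v = (val u != val v) && (val u |: (val v |: t) \in X).
Proof.
have := valP u; have := valP v; rewrite !vertex_link => /andP[vt Xv] /andP[ut Xu].
rewrite /edge /= 3!inE cards2.
have [uv|uv] /= := eqVneq (val u) (val v); first by rewrite andbF.
rewrite andbT [t :|: _]finset.setUC -finset.setUA !cardsU1 !inE negb_or uv ut vt
  !add1n addn2 eqxx andbT; apply/andP/idP => [[]|] // Xuvt; split=> //.
by apply: complexX.2 Xuvt _; rewrite finset.setUA finset.subsetUl.
Qed.

Section Gap.
Variables (t : {set V}) (lam : R).
Hypothesis tn : (#|t| < n)%N.
Hypothesis lam_ge0 : 0 <= lam.
Hypothesis conn : connected_skeleton (link X t).
Hypothesis spec : forall a, walk_spectrum R X n t a -> `|a| <= lam \/ a = 1.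

Let T := vertex (link X t).
Let w (v : T) : R := m (val v |: t).
Let k (u v : T) : R := if edge u v then m (val u |: (val v |: t)) else 0.

(** Masses vanish off [X], so sums over the vertices of the link can be taken over all of [V]
    outside [t], which avoids subtypes that depend on [t]. *)
Let sum_link (F : V -> R) :
  \sum_(v | v \notin t) m (v |: t) * F v = \sum_(v : T) w v * F (val v).
Proof.
transitivity (\sum_(v | [set v] \in link X t) m (v |: t) * F v); last first.
  exact: (big_sub [pred v | [set v] \in link X t] (fun v => m (v |: t) * F v)).
rewrite [RHS]big_mkcond [LHS]big_mkcond; apply: eq_bigr => v _.
rewrite vertex_link; case: (v \in t) => //=; case: ifP => // /negbT Xv.
by rewrite /simplex_mass weight_eq0 ?mul0r.
Qed.

Let sum_edge (v : T) (F : V -> R) :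
  \sum_(u | u \notin val v |: t) m (u |: (val v |: t)) * F u =
  \sum_(u : T) k u v * F (val u).
Proof.
transitivity (\sum_(u : V | [set u] \in link X t)
  (if (u != val v) && (u |: (val v |: t) \in X) then m (u |: (val v |: t))
   else 0) * F u).
  rewrite [RHS]big_mkcond [LHS]big_mkcond; apply: eq_bigr => u _.
  rewrite vertex_link !inE; have [//|uv] := eqVneq u (val v).
    by rewrite mul0r if_same.
  case: (boolP (u \in t)) => //= ut.
  case: (boolP (u |: (_ |: _) \in X)) => [Xuv|Xuv].
    suff -> : u |: t \in X by [].
    by apply: complexX.2 Xuv _; rewrite finset.setUCA finset.subsetUr.
  by rewrite /simplex_mass weight_eq0 // mul0r if_same.
rewrite (big_sub [pred v | [set v] \in link X t]
  (fun u => (if (u != val v) && (u |: (val v |: t) \in X)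
             then m (u |: (val v |: t)) else 0) * F u)) /=.
by apply: eq_bigr => u _; rewrite /k edge_link.
Qed.

(** The masses of the vertices and edges of the link form a reversible kernel: [sum_weight] gives
    its row sums, and dividing by vertex masses yields the operator [walk]. *)
Lemma link_walk_gap : walk_gap X n lam t.
Proof.
rewrite /walk_gap => h g; rewrite !sum_link => g0.
have -> : \sum_(v | v \notin t) h v *
      (\sum_(u | u \notin v |: t) m (u |: (v |: t)) * g u) =
    \sum_(v : T) \sum_(u : T) k u v * h (val v) * g (val u).
  pose G v := h v * \sum_(u | u \notin v |: t) m (u |: (v |: t)) * g u.
  (* A factor m(v + t) is forced in so that [sum_link] applies. Where it is zero, the inner sum is
     zero as well. *)
  transitivity (\sum_(v | v \notin t) m (v |: t) * (G v / m (v |: t))).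
    apply: eq_bigr => v _; have [mv0|mv0] := eqVneq (m (v |: t)) 0; last first.
      by rewrite mulrCA mulfV ?mulr1.
    rewrite mv0 mul0r big1 ?mulr0 // => u _.
    rewrite /simplex_mass weight_eq0 ?mul0r //; apply: contraTN isT => Xuvt.
    have /weight_gt0 : v |: t \in X by apply: complexX.2 Xuvt (finset.subsetUr _ _).
    by rewrite lt0n -(pnatr_eq0 R) -/(m _) mv0 eqxx.
  rewrite (sum_link (fun v => G v / m (v |: t))); apply: eq_bigr => v _.
  rewrite mulrCA mulfV ?mulr1; last first.
    have := valP v; rewrite vertex_link => /andP[_ /weight_gt0].
    by rewrite /w lt0n pnatr_eq0.
  by rewrite /G sum_edge mulr_sumr; apply: eq_bigr => u _; ring.
apply: kernel_spectral_gap => //.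
- by move=> v; rewrite /w /simplex_mass ltr0n weight_gt0 //; have := valP v; rewrite vertex_link => /andP[].
- by move=> u v; rewrite /k; case: ifP.
- by move=> u v; rewrite /k !edge_link eq_sym finset.setUCA.
- move=> v; have /= := sum_edge v (fun=> 1).
  under [in RHS]eq_bigr do rewrite mulr1.
  under eq_bigr do rewrite mulr1.
  move=> <-; rewrite /w /simplex_mass -natr_sum sum_weight // cardsU1; lia.
- move=> phi phiE u v.
  have /connectP[p pp ->] := conn u v.
  elim: p u pp => //= y p IHp u /andP[uy /IHp <-].
  apply: phiE; rewrite /k uy /simplex_mass ltr0n weight_gt0 //.
  by move: uy; rewrite edge_link => /andP[].
- move=> a phi [v0 phi0] phiE; apply: spec; rewrite /walk_spectrum /=.
  pose psi : {ffun T -> R^o} := [ffun v => phi v].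
  have psi0 : psi != 0.
    by apply: contraNneq phi0 => /ffunP/(_ v0); rewrite !ffunE => ->.
  (* Otherwise the eigenspace of [a] is zero, although it contains [psi]. *)
  apply: contraNneq psi0 => ker0.
  rewrite -memv0 -ker0 memv_ker !lfun_simp subr_eq0; apply/eqP/ffunP => v.
  rewrite /= !ffunE.
  have mv : m (val v |: t) != 0.
    have := valP v; rewrite vertex_link => /andP[_ /weight_gt0].
    by rewrite lt0n pnatr_eq0.
  apply: (mulfI mv); rewrite /GRing.scale /= mulrCA.
  have := phiE v; rewrite /w => <-; rewrite mulr_sumr [LHS]big_mkcond.
  apply: eq_bigr => u _; rewrite /k; case: ifP => _; last by rewrite mul0r.
  rewrite ffunE /link_weight [t :|: [set _]]finset.setUC mulrA; congr (_ * _).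
  rewrite mulrCA mulfV ?mulr1 // [t :|: _]finset.setUC -finset.setUA //.
Qed.

End Gap.
End Link.

(** * Counting transversal simplices: the mixing estimate *)

Section Mixing.
Variables (R : realType) (V : finType) (X : {set {set V}}) (n : nat).
Hypothesis complexX : simplicial_complex X.
Implicit Types (t s U : {set V}) (Us : seq {set V}).

(** The count W(t; U_0, ..., U_d), recursive so that each chosen vertex joins [t]. *)
Fixpoint transversals t Us : nat :=
  if Us is U :: Us' then
    (\sum_(v | v \notin t) (v \in U) * transversals (v |: t) Us')%N
  else t \in faces X n.+1.

Lemma size_hit (A : {set V}) Us :
  pairwise (fun U U' : {set V} => [disjoint U & U']) Us ->
  all (fun U => U :&: A != set0) Us -> (size Us <= #|A|)%N.
Proof.
elim: Us A => //= U Us IH A /andP[dU dUs] /andP[UA hA].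
rewrite -(cardsID U A) -addn1 addnC leq_add //.
  by rewrite card_gt0 setIC.
apply: IH => //; apply/allP => W WUs.
have /set0Pn[x /setIP[xW xA]] := allP hA _ WUs.
apply/set0Pn; exists x; rewrite !inE xW xA !andbT /=.
by rewrite (disjointFl (allP dU _ WUs) xW).
Qed.

(** A facet is counted at most once: outside [t] it has exactly [size Us] vertices and meets as many
    disjoint sets, so it has a single vertex in each of them. *)
Lemma transversals_hit t Us :
  pairwise (fun U U' : {set V} => [disjoint U & U']) Us ->
  (#|t| + size Us = n.+1)%N ->
  (transversals t Us <=
    #|[set s in faces X n.+1 |
       (t \subset s) && all (fun U => U :&: (s :\: t) != set0) Us]|)%N.
Proof.
elim: Us t => [|U Us IH] t /=.
  move=> _ ct; case: (boolP (t \in _)) => //= Ft.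
  by apply/card_gt0P; exists t; rewrite !inE in Ft *; rewrite Ft subxx.
case/andP=> dU dUs ct.
pose hit s v := (v |: t \subset s) &&
  all (fun U => U :&: (s :\: (v |: t)) != set0) Us.
set S := [set s in _ | _].
apply: (@leq_trans (\sum_(v | v \notin t) (v \in U) *
    \sum_(s in S) hit s v)).
  apply: leq_sum => v vt; have [vU|] := boolP (v \in U); last by rewrite !mul0n.
  rewrite !mul1n; apply: (leq_trans (IH (v |: t) dUs _)).
    by rewrite cardsU1 vt; lia.
  rewrite -sum1_card big_mkcond /= [X in (_ <= X)%N]big_mkcond /=.
  apply: leq_sum => s _; rewrite !inE; case: ifP => // /andP[Fs hs].
  move: (hs) => /andP[]; rewrite subUset sub1set => /andP[vs ts] hA.
  rewrite Fs ts /hit hs /=; case: ifP => // /negP[]; apply/andP; split.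
    by apply/set0Pn; exists v; rewrite !inE vU vs vt.
  apply: sub_all hA => W; apply: contraNneq => W0; rewrite -subset0 -W0.
  by apply: setIS; apply: setDS; apply: finset.subsetUr.
under eq_bigr do rewrite big_distrr /=.
rewrite exchange_big /= -sum1_card; apply: leq_sum => s.
rewrite !inE => /andP[/andP[_ /eqP cs] /andP[ts /andP[_ hA]]].
(* The possible first vertices are those of [s :\: t] in [U]. The other sets occupy at least
   [size Us] of its [(size Us).+1] vertices, leaving at most one. *)
apply: (@leq_trans #|(s :\: t) :&: U|).
  rewrite -sum1_card big_mkcond [X in (_ <= X)%N]big_mkcond /=.
  apply: leq_sum => v _; rewrite /hit subUset sub1set !inE.
  by case: (v \notin t) (v \in U) (v \in s) => [] [] []; rewrite ?mul1n ?leq_b1.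
rewrite -(leq_add2r #|(s :\: t) :\: U|) cardsID.
have : (size Us <= #|(s :\: t) :\: U|)%N.
  apply: size_hit dUs _; apply/allP => W WUs.
  have /set0Pn[x /setIP[xW xA]] := allP hA _ WUs.
  by apply/set0Pn; exists x; rewrite in_setI xW in_setD xA (disjointFl (allP dU _ WUs) xW).
rewrite (cardsDS ts) cs; lia.
Qed.

Local Notation m := (simplex_mass R X n).
Let one U v : R := (v \in U)%:R.

Definition link_mass t U : R := \sum_(v | v \notin t) m (v |: t) * one U v.

Lemma transversals_eq0 t Us : t \notin X -> transversals t Us = 0%N.
Proof.
elim: Us t => [|U Us IH] t tX /=; first by rewrite inE (negbTE tX).
rewrite big1 // => v _; rewrite IH ?muln0 //; apply: contra tX => Xvt.
exact: complexX.2 Xvt (finset.subsetUr _ _).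
Qed.

Lemma link_mass_ge0 t U : 0 <= link_mass t U.
Proof. by apply: sumr_ge0 => v _; rewrite mulr_ge0 ?ler0n. Qed.

Lemma link_mass_le t U : (#|t| <= n)%N -> link_mass t U <= m t.
Proof.
move=> tn; rewrite /simplex_mass -(sum_weight X tn) natr_sum; apply: ler_sum => v _.
by rewrite ler_piMr ?ler0n // /one lern1; case: (v \in U).
Qed.

Lemma sum_link_mass t U : (#|t| < n)%N ->
  \sum_(v | v \notin t) link_mass (v |: t) U = link_mass t U.
Proof.
move=> tn; rewrite (exchange_big_dep [pred u | u \notin t]) /=; last first.
  by move=> v u vt; rewrite !inE negb_or => /andP[].
apply: eq_bigr => u ut.
rewrite -mulr_suml; congr (_ * _).
rewrite /simplex_mass -(sum_weight (n := n) X (s := u |: t)) ?cardsU1 ?ut // natr_sum.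
apply: eq_big => v.
  by rewrite !inE !negb_or ut andbT andbC eq_sym.
by move=> _; rewrite finset.setUCA.
Qed.

Variable lam : R.
Hypothesis lam_ge0 : 0 <= lam.
Hypothesis gap : forall t, t \in X -> (#|t| < n)%N -> walk_gap X n lam t.

(** The proportion a_t(U). It is 0 when [t] is not a simplex, since then [m t] is 0 and division by
    0 gives 0. *)
Let density t U := link_mass t U / m t.

Let density_ge0 t U : 0 <= density t U.
Proof. by rewrite divr_ge0 ?link_mass_ge0 ?ler0n. Qed.

Let density_le1 t U : (#|t| <= n)%N -> density t U <= 1.
Proof.
move=> tn; have := link_mass_le U tn; rewrite /density.
have [->|m0 le] := eqVneq (m t) 0; first by rewrite invr0 mulr0.
by rewrite ler_pdivrMr ?mul1r // lt_neqAle eq_sym m0 ler0n.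
Qed.

Let density_mass t U : (#|t| <= n)%N -> m t * density t U = link_mass t U.
Proof.
move=> tn; have := link_mass_le U tn; have := link_mass_ge0 t U.
rewrite /density; have [-> a b|m0 _ _] := eqVneq (m t) 0.
  by rewrite mul0r; lra.
by rewrite mulrCA mulfV ?mulr1.
Qed.

(** The difference of densities times m(v + t) is the unnormalized walk applied to the centered
    indicator of [U], so the gap applies. Allowing any [h] below the indicator of [F] lets [h]
    absorb further densities later. *)
Lemma mixing_step t U (h : V -> R) F : t \in X -> (#|t| < n)%N ->
  (forall v, 0 <= h v <= one F v) ->
  `|\sum_(v | v \notin t) m (v |: t) * h v * (density (v |: t) U - density t U)|
    <= lam / 2 * (link_mass t F + link_mass t U).
Proof.
move=> Xt tn hF; pose g v := one U v - density t U.
have massg : \sum_(v | v \notin t) m (v |: t) * g v = 0.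
  under eq_bigr do rewrite mulrBr.
  rewrite sumrB -mulr_suml -natr_sum sum_weight ?(ltnW tn) //.
  by rewrite -/(m t) density_mass ?subrr // ltnW.
have -> : \sum_(v | v \notin t) m (v |: t) * h v *
            (density (v |: t) U - density t U) =
    \sum_(v | v \notin t) h v *
      \sum_(u | u \notin v |: t) m (u |: (v |: t)) * g u.
  apply: eq_bigr => v vt.
  have vtn : (#|v |: t| <= n)%N by rewrite cardsU1 vt.
  under [X in _ = _ * X]eq_bigr do rewrite mulrBr.
  rewrite sumrB -mulr_suml -natr_sum sum_weight // -/(m _).
  rewrite -/(link_mass (v |: t) U) -density_mass //; ring.
apply: le_trans (gap Xt tn h massg) _.
rewrite ler_wpM2l ?divr_ge0 //.
under eq_bigr do rewrite mulrDr.
rewrite big_split /= lerD //.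
  apply: ler_sum => v _; rewrite ler_wpM2l ?ler0n //.
  by have := hF v; rewrite /one; case: (v \in F) => /= /andP[h0 h1]; nra.
(* With a = [density t U], the square of g is (1_U - a^2) - 2 a g, and g has weighted sum zero. *)
have <- : \sum_(v | v \notin t) m (v |: t) * (one U v - density t U ^+ 2)
  + 2 * density t U * \sum_(v | v \notin t) m (v |: t) * (- g v) =
  \sum_(v | v \notin t) m (v |: t) * g v ^+ 2.
  rewrite mulr_sumr -big_split; apply: eq_bigr => v _ /=.
  by rewrite /g /one; case: (v \in U) => /=; ring.
under [X in _ + _ * X]eq_bigr do rewrite mulrN.
rewrite sumrN massg oppr0 mulr0 addr0; apply: ler_sum => v _.
by rewrite ler_wpM2l ?ler0n // lerBlDr lerDl sqr_ge0.
Qed.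

(** The densities at v + t are replaced one at a time: the first factor is absorbed into [h] to
    treat the others by induction, and is then replaced by [mixing_step]. All remaining factors lie
    in [0, 1]. *)
Lemma mixing_telescope t Us (h : V -> R) F : t \in X -> (#|t| < n)%N ->
  (forall v, 0 <= h v <= one F v) ->
  `|\sum_(v | v \notin t) m (v |: t) * h v * \prod_(U <- Us) density (v |: t) U
    - (\sum_(v | v \notin t) m (v |: t) * h v) * \prod_(U <- Us) density t U|
  <= lam / 2 * \sum_(U <- Us) (link_mass t F + link_mass t U).
Proof.
move=> Xt tn; elim: Us h => [|U Us IH] h hF.
  rewrite !big_nil !mulr1 mulr0.
  by under eq_bigr do rewrite big_nil mulr1; rewrite subrr normr0.
pose h' v := if v \in t then h v else h v * density (v |: t) U.
have h'F v : 0 <= h' v <= one F v.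
  rewrite /h'; case: ifP => // /negbT vt; have /andP[h0 h1] := hF v.
  rewrite mulr_ge0 //=; apply: le_trans h1; rewrite ler_piMr // density_le1 //.
  by rewrite cardsU1 vt.
have {IH} IH := IH h' h'F.
have step := mixing_step U Xt tn hF.
set c := \prod_(U <- Us) density t U in IH *.
have c01 : 0 <= c <= 1.
  rewrite prodr_ge0 //= prodr_ile1 // => ? _.
  by rewrite density_ge0 density_le1 // ltnW.
rewrite !big_cons -/c mulrDr.
set D := \sum_(v | v \notin t) m (v |: t) * h v * (_ - _) in step.
set S' := \sum_(v | v \notin t) _ * \prod_(U <- Us) _ in IH.
have -> : \sum_(v | v \notin t) m (v |: t) * h v *
    \prod_(U <- U :: Us) density (v |: t) U = S'.
  by apply: eq_bigr => v vt; rewrite big_cons /h' (negbTE vt) !mulrA.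
have DE : D = \sum_(v | v \notin t) m (v |: t) * h' v
  - (\sum_(v | v \notin t) m (v |: t) * h v) * density t U.
  rewrite mulr_suml -sumrB; apply: eq_bigr => v vt.
  by rewrite /h' (negbTE vt); ring.
have -> : S' - (\sum_(v | v \notin t) m (v |: t) * h v) * (density t U * c) =
  (S' - (\sum_(v | v \notin t) m (v |: t) * h' v) * c) + D * c.
  by rewrite DE; ring.
apply: le_trans (ler_normD _ _) _; rewrite addrC lerD //.
apply: le_trans step; rewrite normrM ler_piMr //.
by case/andP: c01 => c0 c1; rewrite ger0_norm.
Qed.

Theorem mixing t Us : t \in X -> (#|t| + size Us = n.+1)%N ->
  `|(transversals t Us)%:R - m t * \prod_(U <- Us) density t U|
    <= lam * (size Us).-1%:R / 2 * \sum_(U <- Us) link_mass t U.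
Proof.
elim: Us t => [|U Us IH] t Xt /= sz.
  rewrite !big_nil mulr1 mulr0 /simplex_mass.
  have Ft : t \in faces X n.+1 by rewrite inE Xt -sz addn0 eqxx.
  by rewrite Ft weight_facet // subrr normr0.
have tn : (#|t| <= n)%N by lia.
pose P v := m (v |: t) * \prod_(U <- Us) density (v |: t) U.
have bound v : v \notin t -> `|(transversals (v |: t) Us)%:R - P v|
    <= lam * (size Us).-1%:R / 2 * \sum_(U <- Us) link_mass (v |: t) U.
  move=> vt; have [Xvt|Xvt] := boolP (v |: t \in X).
    by apply: IH; rewrite // cardsU1 vt; lia.
  rewrite transversals_eq0 // /P /simplex_mass weight_eq0 // mul0r subrr normr0.
  by rewrite mulr_ge0 ?divr_ge0 ?mulr_ge0 ?sumr_ge0 // => ? _; apply: link_mass_ge0.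
have -> : (\sum_(v | v \notin t) (v \in U) * transversals (v |: t) Us)%:R
   - m t * \prod_(U <- U :: Us) density t U =
   \sum_(v | v \notin t) one U v * ((transversals (v |: t) Us)%:R - P v) +
   (\sum_(v | v \notin t) m (v |: t) * one U v *
      \prod_(U <- Us) density (v |: t) U
    - (\sum_(v | v \notin t) m (v |: t) * one U v) * \prod_(U <- Us) density t U).
  rewrite big_cons mulrA density_mass // addrA -big_split natr_sum /=.
  congr (_ - _); apply: eq_bigr => v _; rewrite natrM /P -/(one U v); ring.
apply: le_trans (ler_normD _ _) _.
have Sle : `|\sum_(v | v \notin t) one U v * ((transversals (v |: t) Us)%:R - P v)|
    <= lam * (size Us).-1%:R / 2 *
       \sum_(v | v \notin t) \sum_(W <- Us) link_mass (v |: t) W.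
  rewrite mulr_sumr; apply: le_trans (ler_norm_sum _ _ _) (ler_sum _ _) => v vt.
  apply: le_trans (bound v vt); rewrite normrM ler_piMl // /one.
  by case: (v \in U); rewrite /= ?normr1 ?normr0.
(* When [U] is the last set, [t] has [n] vertices and no gap is assumed at [t], but the count is
   then exact. *)
case: (posnP (size Us)) => [/size0nil Us0|Us_gt0].
  move: Sle; rewrite Us0 !big_nil mulr0 mul0r => Sle.
  under [X in _ + `|X - _|]eq_bigr do rewrite big_nil mulr1.
  rewrite mulr1 subrr normr0 addr0; apply: le_trans Sle _.
  by rewrite big1 ?mulr0 ?mul0r // => v _; rewrite big_nil.
have tn' : (#|t| < n)%N by lia.
have UF v : 0 <= one U v <= one U v by rewrite ler0n lexx.
have tele := mixing_telescope Us Xt tn' UF.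
apply: le_trans (lerD Sle tele) _.
rewrite exchange_big /=.
under [X in _ * X + _]eq_bigr do rewrite sum_link_mass //.
(* With d = [size Us], each set of [Us] receives (d - 1)/2 from the induction and 1/2 from
   telescoping, while [U] receives 1/2 from each of the d replacements: d/2 in every case. *)
rewrite big_split /= big_cons big_const_seq count_predT iter_addr addr0 -mulr_natr.
rewrite -[in X in _ <= _ * X / _ * _](prednK Us_gt0) -[in X in _ * (X + _)](prednK Us_gt0).
rewrite -addn1 natrD le_eqVlt; apply/orP; left; apply/eqP; by field.
Qed.

End Mixing.

(** * Compactness for linear systems; convex hulls of finite families *)

Section Convexity.
Variable R : realType.

(** The total residual is continuous on the compact cube, so it attains its minimum, which
    approximate solvability forces to be 0. *)
Lemma cube_linear_system (I Q : finType) (B : I -> Q -> R) (c : Q -> R) :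
  (forall d, 0 < d -> exists2 a : I -> R, forall i, 0 <= a i <= 1 &
     forall q, `|\sum_i a i * B i q - c q| <= d) ->
  exists2 a : I -> R, forall i, 0 <= a i <= 1 &
    forall q, \sum_i a i * B i q = c q.
Proof.
move=> approx.
have cK := @rV_compact R #|I| (fun=> `[0, 1]%classic)
  (fun=> segment_compact (a := 0) (b := 1)).
set K := (X in compact X) in cK.
pose F (a : 'rV[R]_#|I|) :=
  \sum_q `|\sum_i a ord0 (enum_rank i) * B i q - c q|.
have cG q : continuous (fun a : 'rV[R]_#|I| =>
    (\sum_i a ord0 (enum_rank i) * B i q - c q : R^o)).
  move=> a; have fa : Filter (nbhs a) by exact: nbhs_filter.
  apply: (@cvgB _ _ _ _ fa); last exact: (@cvg_cst _ _ _ _ fa).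
  apply: (@cvg_big _ _ _ _ _ _ _ _ _ _ _ fa) => [|i _]; first exact: add_continuous.
  by apply: (@cvgM _ _ _ fa); [exact: coord_continuous | exact: (@cvg_cst _ _ _ _ fa)].
have cF : continuous F.
  move=> a; have fa : Filter (nbhs a) by exact: nbhs_filter.
  apply: (@cvg_big _ _ _ _ _ _ _ _ _ _ _ fa) => [|q _]; first exact: add_continuous.
  by apply: (@cvg_norm _ _ _ _ fa); apply: cG.
have K0 : (K !=set0)%classic.
  by exists 0 => i; rewrite mxE /= in_itv /= lexx ler01.
have [a0 /set_mem a0K minF] := compact_EVT_min K0 cK (continuous_subspaceT cF).
have F0 : F a0 = 0.
  apply/eqP; rewrite eq_le sumr_ge0 // andbT.
  apply/ler_addgt0Pr => e e0; rewrite add0r.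
  have d0 : 0 < e / #|Q|.+1%:R by rewrite divr_gt0.
  have [a a01 ad] := approx _ d0.
  have aK : (\row_i a (enum_val i)) \in K.
    by apply/mem_set => i; rewrite mxE /= in_itv /=.
  apply: le_trans (minF _ aK) _.
  apply: (@le_trans _ _ (\sum_(q : Q) e / #|Q|.+1%:R)).
    apply: ler_sum => q _; apply: le_trans (ad q).
    by under eq_bigr do rewrite mxE enum_rankK.
  rewrite sumr_const -[_ *+ #|_|]mulr_natr mulrAC ler_pdivrMr // ler_wpM2l ?(ltW e0) //.
  by rewrite ler_nat.
exists (fun i => a0 ord0 (enum_rank i)) => [i|q].
  by have := a0K (enum_rank i); rewrite /= in_itv.
apply/eqP; rewrite -subr_eq0 -normr_eq0; apply/eqP; move: q (erefl true).
by move: F0 => /psumr_eq0P F0 q _; apply: F0.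
Qed.

(** The convex combinations form a convex set containing the points. Conversely, a convex set
    contains every normalized partial sum, by adding one point at a time. *)
Lemma conv_hull_rangeP n (I : finType) (x : I -> 'rV[R]_n) y :
  conv_hull (range x) y <->
  exists2 a : I -> R, (forall i, 0 <= a i) /\ \sum_i a i = 1 &
    y = \sum_i a i *: x i.
Proof.
split=> [|[a [a_ge0 a1] ->] C [convC xC]].
  pose C := [set y | exists2 a : I -> R, (forall i, 0 <= a i) /\ \sum_i a i = 1 &
    y = \sum_i a i *: x i]%classic.
  apply: (_ : _ -> C y); apply; split.
    move=> _ _ lam /set_mem[a [a0 a1] ->] /set_mem[b [b0 b1] ->].
    apply/mem_set; exists (fun i => lam%:num * a i + (1 - lam%:num) * b i).
      split=> [i|].
        by rewrite addr_ge0 ?mulr_ge0 // subr_ge0.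
      by rewrite big_split /= -!mulr_sumr a1 b1; ring.
    under [RHS]eq_bigr do rewrite scalerDl -!scalerA.
    by rewrite big_split /= -!scaler_sumr.
  move=> _ [i _ <-]; exists (fun j => (j == i)%:R).
    by split=> [j|]; rewrite ?ler0n // (bigD1 i) //= eqxx big1 ?addr0 // => j /negbTE ->.
  rewrite (bigD1 i) //= eqxx scale1r big1 ?addr0 // => j /negbTE ->.
  by rewrite scale0r.
have conv r : 0 < \sum_(i <- r) a i ->
    C ((\sum_(i <- r) a i)^-1 *: \sum_(i <- r) a i *: x i).
  elim: r => [|i r IH]; first by rewrite big_nil ltxx.
  rewrite !big_cons; set s := \sum_(j <- r) a j in IH *.
  have s_ge0 : 0 <= s by apply: sumr_ge0.
  have xi : C (x i) by apply: xC; exists i.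
  (* A partial sum of zero mass cannot be normalized, but then all its terms vanish. *)
  have [s0|s0] := eqVneq s 0.
    rewrite s0 addr0 => ai; rewrite [X in _ + X](_ : _ = 0) ?addr0.
      by rewrite scalerA mulVf ?gt_eqF // scale1r.
    have /allP az : all (fun j => xpredT j ==> (a j == 0)) r.
      by rewrite -psumr_eq0 // -/s s0.
    rewrite big1_seq // => j /andP[_ jr].
    by move: (az j jr) => /= /eqP ->; rewrite scale0r.
  have s_gt0 : 0 < s by rewrite lt_neqAle eq_sym s0.
  move=> as_gt0; have {}IH := IH s_gt0.
  have p0 : 0 <= a i / (a i + s) by rewrite divr_ge0 // ltW.
  have p1 : a i / (a i + s) <= 1 by rewrite ler_pdivrMr // mul1r lerDl.
  have := convC _ _ (Itv01 p0 p1) (mem_set xi) (mem_set IH).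
  move/set_mem; rewrite /conv /= /unstable.onem; congr C.
  rewrite scalerDr !scalerA mulrC; congr (_ + _ *: _); field.
  by rewrite !gt_eqF.
have := conv (index_enum I); rewrite a1 invr1 scale1r; apply; exact: ltr01.
Qed.

End Convexity.

(** * Pach's theorem for families with repetitions *)

Section Pach.
Variable R : realType.

Lemma small_forall (Q : finType) (A : Q -> R -> Prop) :
  (forall q, exists2 d, 0 < d & forall e, 0 < e < d -> A q e) ->
  exists2 d, 0 < d & forall e, 0 < e < d -> forall q, A q e.
Proof.
move=> nearA.
suff [d d0 dA] : exists2 d, 0 < d &
    forall e, 0 < e < d -> forall q, q \in enum Q -> A q e.
  by exists d => // e /dA eA q; apply: eA; rewrite mem_enum.
elim: (enum Q) => [|q r [d d0 dA]]; first by exists 1.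
have [d' d'0 d'A] := nearA q.
exists (Num.min d d'); first by rewrite lt_min d0.
move=> e /andP[e0]; rewrite lt_min => /andP[ed ed'] p.
rewrite in_cons => /orP[/eqP->|]; first by apply: d'A; rewrite e0.
by apply: dA; rewrite e0.
Qed.

Variables (n : nat) (P : R) (T : finType).
Hypothesis pachP : pach_constant n P.

Lemma pach_injective (f : T -> 'rV[R]_n) (S : 'I_n.+1 -> {set T}) :
  injective f ->
  exists2 U : 'I_n.+1 -> {set T},
    forall i, U i \subset S i /\ P * #|S i|%:R <= #|U i|%:R &
    exists y, forall x : 'I_n.+1 -> T,
      (forall i, x i \in U i) -> conv_hull (range (fun i => f (x i))) y.
Proof.
move=> injf; have [_] := pachP.
pose F (B : {set T}) := seq_fset tt [seq f v | v <- enum B].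
have cF B : #|` F B| = #|B|.
  by rewrite size_seq_fset undup_id ?size_map -?cardE // map_inj_uniq ?enum_uniq.
have memF B x : (x \in F B) = (x \in [seq f v | v <- enum B]).
  by rewrite seq_fsetE.
case/(_ (fun i => F (S i))) => U [US [y yU]].
exists (fun i => [set v in S i | f v \in U i]) => [i|].
  split; first by apply/fintype.subsetP => v; rewrite inE => /andP[].
  have [/fsubsetP sub le] := US i.
  rewrite cF in le; apply: le_trans le _; rewrite ler_nat -cF.
  apply: fsubset_leq_card; apply/fsubsetP => z zU; rewrite memF.
  have := sub z zU; rewrite memF => /mapP[v]; rewrite mem_enum => vS zE.
  by apply/mapP; exists v => //; rewrite mem_enum inE vS -zE.
by exists y => x xU; apply: yU => i; have := xU i; rewrite inE => /andP[].
Qed.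

Hypothesis n_gt0 : (0 < n)%N.

(** Points move along the diagonal by distinct multiples of [e], so any two of them collide for at
    most one value of [e]. *)
Let perturb (f : T -> 'rV[R]_n) e v : 'rV[R]_n :=
  f v + (e * (enum_rank v)%:R) *: const_mx 1.

Let perturb_injective f :
  exists2 d, 0 < d & forall e, 0 < e < d -> injective (perturb f e).
Proof.
have [d d0 dinj] : exists2 d, 0 < d & forall e, 0 < e < d ->
    forall p : T * T, perturb f e p.1 = perturb f e p.2 -> p.1 = p.2.
  apply: small_forall => -[v w] /=.
  have [->|vw] := eqVneq v w; first by exists 1.
  pose j := Ordinal n_gt0.
  pose k : R := (enum_rank w)%:R - (enum_rank v)%:R.
  have k0 : k != 0.
    rewrite subr_eq0 eqr_nat; apply: contraNneq vw => /val_inj/enum_rank_inj.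
    by move=> ->.
  pose b := (f v 0 j - f w 0 j) / k.
  have bad e : perturb f e v = perturb f e w -> e = b.
    move/rowP/(_ j); rewrite !mxE => ef; apply: (mulIf k0).
    by rewrite /b mulfVK // /k; lra.
  have [b_le0|b_gt0] := leP b 0.
    by exists 1 => // e /andP[e0 _] /bad eb; move: e0; rewrite eb ltNge b_le0.
  by exists b => // e /andP[_ eb] /bad e_b; move: eb; rewrite e_b ltxx.
by exists d => // e ed v w; apply: (dinj e ed (v, w)).
Qed.

(* Pach's theorem speaks of sets of points; for a family of points with
   repetitions, perturb the points to make them distinct, and let the
   perturbation tend to zero. *)
Lemma pach_family (f : T -> 'rV[R]_n) (S : 'I_n.+1 -> {set T}) :
  exists2 U : 'I_n.+1 -> {set T},
    forall i, U i \subset S i /\ P * #|S i|%:R <= #|U i|%:R &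
    exists y, forall x : 'I_n.+1 -> T,
      (forall i, x i \in U i) -> conv_hull (range (fun i => f (x i))) y.
Proof.
pose large (U : 'I_n.+1 -> {set T}) :=
  forall i, U i \subset S i /\ P * #|S i|%:R <= #|U i|%:R.
pose good (U : {ffun 'I_n.+1 -> {set T}}) e := large U /\
  exists y, forall x : 'I_n.+1 -> T,
    (forall i, x i \in U i) -> conv_hull (range (fun i => perturb f e (x i))) y.
(* Pigeonhole: there are finitely many candidates [U], so one of them works for arbitrarily small
   [e]. *)
have [U goodU] : exists U, forall d, 0 < d -> exists2 e, 0 < e < d & good U e.
  apply/not_existsP => bad.
  have [d d0 dbad] : exists2 d, 0 < d & forall e, 0 < e < d -> forall U, ~ good U e.
    apply: small_forall => U; have := bad U.
    move=> /existsNP[d /not_implyP[d0 /forall2NP dgood]].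
    by exists d => // e ed; have [] := dgood e.
  have [d' d'0 dinj] := perturb_injective f.
  pose e := Num.min d d' / 2.
  have e0 : 0 < e by rewrite divr_gt0 // lt_min d0.
  have e_min : e < Num.min d d' by rewrite gtr_pMr ?invf_lt1 ?ltr1n // lt_min d0.
  have [ed ed'] : e < d /\ e < d' by move: e_min; rewrite lt_min => /andP[].
  have ie : injective (perturb f e) by apply: dinj; rewrite e0.
  have [U largeU [y yU]] := pach_injective S ie.
  apply: (dbad e _ (finfun U)); first by rewrite e0.
  split=> [i|]; first by rewrite ffunE.
  by exists y => x xU; apply: yU => i; have := xU i; rewrite ffunE.
have largeU : large U by have [e _ []] := goodU _ ltr01.
exists U => //.
pose adm (x : {ffun 'I_n.+1 -> T}) := [forall i, x i \in U i].
have [x0 adm0|noadm] := pickP adm; last first.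
  exists 0 => x xU; have /negbT/negP[] := noadm (finfun x).
  by apply/forallP => i; rewrite ffunE.
(* The unknowns are barycentric weights for each transversal. The equations say that weights sum to
   1 ([None]) and that coordinate j of the combination agrees with that of [x0] ([Some j]), which
   eliminates the common point. The weights lie in a cube, so approximate solutions suffice. *)
pose B (p : {ffun 'I_n.+1 -> T} * 'I_n.+1) (q : {ffun 'I_n.+1 -> T} * option 'I_n) : R :=
  if adm q.1 then
    if q.2 is Some j then
      (p.1 == q.1)%:R * f (p.1 p.2) 0 j - (p.1 == x0)%:R * f (p.1 p.2) 0 j
    else (p.1 == q.1)%:R
  else 0.
pose c (q : {ffun 'I_n.+1 -> T} * option 'I_n) : R :=
  if adm q.1 then if q.2 is Some _ then 0 else 1 else 0.
have sumE (a h : {ffun 'I_n.+1 -> T} * 'I_n.+1 -> R) (x : {ffun 'I_n.+1 -> T}) :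
    \sum_p a p * ((p.1 == x)%:R * h p) = \sum_i a (x, i) * h (x, i).
  transitivity (\sum_y \sum_i a (y, i) * ((y == x)%:R * h (y, i))).
    by rewrite pair_bigA; apply: eq_bigr => -[].
  rewrite (bigD1 x) //= [X in _ + X]big1 ?addr0 => [|y /negbTE ->].
    by apply: eq_bigr => i _; rewrite eqxx mul1r.
  by rewrite big1 // => i _; rewrite mul0r mulr0.
have sumB a q : adm q.1 -> \sum_p a p * B p q =
   if q.2 is Some j then \sum_i a (q.1, i) * f (q.1 i) 0 j -
                         \sum_i a (x0, i) * f (x0 i) 0 j
   else \sum_i a (q.1, i).
  rewrite /B => ->; case: q.2 => [j|].
    under eq_bigr do rewrite mulrBr.
    by rewrite sumrB !(sumE a (fun p => f (p.1 p.2) 0 j)).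
  under eq_bigr do rewrite -[(_ == _)%:R]mulr1.
  by rewrite (sumE a (fun=> 1)); apply: eq_bigr => i _; rewrite mulr1.
have [d d0|a a01 aB] := @cube_linear_system R _ _ B c.
  (* Removing the perturbation moves a combination by [e] times an average of ranks, at most
     [e * #|T|]; the successor avoids a zero denominator. *)
  have [e /andP[e0 ed] [_ [y yU]]] := goodU (d / #|T|.+1%:R) (divr_gt0 d0 (ltr0Sn _ _)).
  have coefs (x : {ffun 'I_n.+1 -> T}) : exists b : 'I_n.+1 -> R,
      (forall i, 0 <= b i <= 1) /\
      (adm x -> \sum_i b i = 1 /\ y = \sum_i b i *: perturb f e (x i)).
    have [admx|nadm] := boolP (adm x); last first.
      by exists (fun=> 0); split => // i; rewrite lexx ler01.
    have /conv_hull_rangeP[b [b0 b1] yE] := yU x (fun i => forallP admx i).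
    exists b; split => // i; rewrite b0 /= -b1 (bigD1 i) //= lerDl.
    exact: sumr_ge0.
  have [b bP] := choice coefs.
  exists (fun p => b p.1 p.2) => [p|q]; first exact: (bP p.1).1.
  have [admq|nadm] := boolP (adm q.1); last first.
    rewrite /c (negbTE nadm) big1 ?subrr ?normr0 ?(ltW d0) // => p _.
    by rewrite /B (negbTE nadm) mulr0.
  rewrite sumB // /c admq; case: q.2 => [j|]; last first.
    by have [-> _] := (bP q.1).2 admq; rewrite subrr normr0 ltW.
  pose r x := \sum_i b x i * (enum_rank (x i))%:R.
  have rT x : adm x -> 0 <= r x <= #|T|%:R.
    move=> admx; have bx := (bP x).1; have [b1 _] := (bP x).2 admx.
    rewrite sumr_ge0 /= => [|i _]; last by have /andP[b0 _] := bx i; rewrite mulr_ge0.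
    rewrite -[X in _ <= X]mul1r -[X in X * _]b1 mulr_suml; apply: ler_sum => i _.
    have /andP[b0 _] := bx i.
    by rewrite ler_wpM2l // ler_nat ltnW.
  have yE x : adm x -> \sum_i b x i * f (x i) 0 j = y 0 j - e * r x.
    move=> admx; have [_ ->] := (bP x).2 admx.
    rewrite summxE mulr_sumr -sumrB; apply: eq_bigr => i _.
    by rewrite !mxE; ring.
  rewrite /= !yE // subr0 [X in `|X|](_ : _ = e * (r x0 - r q.1)); last by ring.
  have /andP[? ?] := rT _ adm0; have /andP[? ?] := rT _ admq.
  rewrite normrM (gtr0_norm e0); apply: (@le_trans _ _ (e * #|T|%:R)).
    by rewrite ler_wpM2l ?(ltW e0) // ler_norml; apply/andP; split; lra.
  move: ed; rewrite ltr_pdivlMr // => /ltW; apply: le_trans.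
  by rewrite ler_wpM2l ?(ltW e0) // ler_nat.
exists (\row_j \sum_i a (x0, i) * f (x0 i) 0 j) => x xU.
pose x' := [ffun i => x i].
have admx : adm x' by apply/forallP => i; rewrite ffunE.
apply/conv_hull_rangeP; exists (fun i => a (x', i)).
  split=> [i|]; first by have /andP[] := a01 (x', i).
  by have := aB (x', None); rewrite sumB //= /c admx.
apply/rowP => j; rewrite mxE summxE.
have := aB (x', Some j); rewrite sumB //= /c admx => /eqP; rewrite subr_eq0 => /eqP <-.
by apply: eq_bigr => i _; rewrite !mxE ffunE.
Qed.

End Pach.

(** * Numerical estimates *)

Lemma bernoulli (R : realType) (x : R) k : 0 <= x <= 1 ->
  1 - k%:R * x <= (1 - x) ^+ k.
Proof.
case/andP=> x0 x1; elim: k => [|k IH]; first by rewrite mul0r subr0 expr0.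
rewrite exprS; have k0 : 0 <= k%:R :> R by [].
rewrite -natr1; apply: (@le_trans _ _ ((1 - x) * (1 - k%:R * x))); last first.
  by rewrite ler_wpM2l ?subr_ge0.
have := mulr_ge0 k0 (mulr_ge0 x0 x0); lra.
Qed.

(** Each summand is (k + 1)((k + 2)^(n - k) - (k + 1)^(n - k)), and the bracket is a positive
    integer. *)
Lemma mixing_constant_ge (R : realType) n :
  n%:R * n.+1%:R / 2 <= mixing_constant R n.
Proof.
have -> : n%:R * n.+1%:R / 2 = \sum_(0 <= k < n) k.+1%:R :> R.
  elim: n => [|n IH]; first by rewrite big_geq // !mul0r.
  by rewrite big_nat_recr //= -IH -!natr1; field.
rewrite /mixing_constant !big_mkord; apply: ler_sum => k _.
rewrite exprS -mulrBr -[X in X <= _]mulr1 ler_wpM2l //.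
rewrite -!natrX -natrB ?ler1n ?subn_gt0; last by rewrite leq_exp2r // subn_gt0.
by rewrite ltn_exp2r // subn_gt0.
Qed.

Lemma pach_constant_le1 (R : realType) n (P : R) : pach_constant n P -> P <= 1.
Proof.
case=> _ /(_ (fun=> [fset 0]%fset)) [U [US _]].
have [/fsubset_leq_card le Ple] := US ord0.
move: le Ple; rewrite cardfs1 mulr1 => le Ple.
by apply: le_trans Ple _; rewrite (ler_nat R _ 1).
Qed.

(** With p = P / (n + 1), the proportion u / N is at least b >= p (1 - n / N). Bernoulli's
    inequality bounds the rounding loss in powers of b, and n / N <= n lam absorbs it. *)
Lemma overlap_arith (R : realType) n (N u : nat) (P lam C ov : R) :
  (1 <= n)%N -> (n < N)%N -> 0 < P -> P <= 1 -> N%:R^-1 <= lam ->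
  n%:R * n.+1%:R / 2 <= C -> P * (N %/ n.+1)%:R <= u%:R -> 0 <= ov ->
  n.+1`!%:R * ((u%:R / N%:R) ^+ n.+1
     - lam * (n%:R * n.+1%:R / 2) * (u%:R / N%:R)) <= ov ->
  n`!%:R * P * ((P / n.+1%:R) ^+ n - n.+1%:R * C * lam) <= ov.
Proof.
move=> n1 nN P0 P1 lamN DC Pu ov0 ovE.
set a := u%:R / N%:R in ovE; set D := n%:R * n.+1%:R / 2 in DC ovE.
pose p := P / n.+1%:R; pose x : R := n%:R / N%:R.
pose b := P * (N %/ n.+1)%:R / N%:R.
have N0 : 0 < N%:R :> R by rewrite ltr0n; lia.
have n0 : 1 <= n%:R :> R by rewrite ler1n.
have lam0 : 0 <= lam by apply: le_trans lamN; rewrite invr_ge0 ltW.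
have p0 : 0 < p by rewrite divr_gt0.
have x01 : 0 <= x <= 1.
  by rewrite divr_ge0 //= ler_pdivrMr // mul1r ler_nat ltnW.
have xlam : x <= n%:R * lam by rewrite ler_wpM2l.
have D1 : 1 <= D.
  have : 2 <= n.+1%:R :> R by rewrite ler_nat.
  by move=> n2; rewrite /D ler_pdivlMr // mul1r (le_trans n2) // ler_peMl.
have pn1 : n.+1%:R * p = P by rewrite mulrC divfK.
(* The remainder of N modulo n + 1 is at most n. *)
have bp : p * (1 - x) <= b.
  rewrite /b /x -(ler_pM2r N0) mulfVK ?gt_eqF // -mulrA mulrBl mul1r mulfVK ?gt_eqF //.
  rewrite /p -mulrA ler_pM2l // mulrC ler_pdivrMr // lerBlDr.
  by rewrite -natrM -natrD ler_nat {1}(divn_eq N n.+1) leq_add2l -ltnS ltn_pmod.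
have b_le : b <= p.
  rewrite /b /p -mulrA ler_pM2l // ler_pdivrMr // mulrC ler_pdivlMr //.
  by rewrite -natrM ler_nat leq_divM.
have b_ge0 : 0 <= b by rewrite /b divr_ge0 ?mulr_ge0 // ltW.
have ba : b <= a by rewrite /a /b ler_pM2r ?invr_gt0.
have bx k : p ^+ k * (1 - k%:R * x) <= b ^+ k.
  apply: (@le_trans _ _ ((p * (1 - x)) ^+ k)).
    by rewrite [leRHS]exprMn ler_wpM2l ?exprn_ge0 ?(ltW p0) // bernoulli.
  by apply: lerXn2r => //; rewrite nnegrE mulr_ge0 ?(ltW p0) // subr_ge0; case/andP: x01.
have p_le1 : p <= 1.
  by rewrite ler_pdivrMr // mul1r (le_trans P1) // ler1n.
have pn : n.+1%:R * p ^+ n <= 1.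
  rewrite -(prednK n1) exprS mulrA prednK // pn1 mulr_ile1 ?exprn_ile1 ?exprn_ge0 //;
    exact: ltW.
have p_ge0 : 0 <= p ^+ n by rewrite exprn_ge0 // ltW.
(* In the first case the claimed bound is nonpositive. In the second, replacing a by the smaller b
   is monotone because both factors are nonnegative. *)
have [small|big] := leP (b ^+ n) (lam * D).
  apply: le_trans ov0; rewrite mulr_ge0_le0 ?mulr_ge0 ?(ltW P0) // subr_le0 -/p.
  have bern := bx n; have lamD : lam * D <= lam * C by rewrite ler_wpM2l.
  have loss : p ^+ n * (n%:R * x) <= n%:R * C * lam.
    apply: (@le_trans _ _ x).
      rewrite mulrA ler_piMl //; first by case/andP: x01.
      by apply: le_trans pn; rewrite mulrC ler_wpM2r // ler_nat.
    by apply: le_trans xlam _; rewrite -mulrA ler_wpM2l // ler_peMl //; lra.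
  by rewrite -natr1; lra.
have mono : b * (b ^+ n - lam * D) <= a * (a ^+ n - lam * D).
  have : b ^+ n <= a ^+ n by apply: lerXn2r => //; rewrite nnegrE // (le_trans b_ge0).
  by move=> bna; rewrite ler_pM ?subr_ge0 ?(ltW big) // lerD2r.
apply: le_trans ovE; rewrite factS natrM -{1}pn1 -/p.
rewrite [leLHS](_ : _ = n.+1%:R * n`!%:R * (p * (p ^+ n - n.+1%:R * C * lam))); last by ring.
rewrite ler_wpM2l ?mulr_ge0 // [leRHS](_ : _ = a * (a ^+ n - lam * D)); last first.
  by rewrite exprS; ring.
(* Of the n + 1 copies of C lam, one pays for the mixing error and n for rounding. *)
apply: le_trans mono; have bern := bx n.+1; rewrite !exprS in bern.
have lamD : lam * D * b <= lam * C * p.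
  by rewrite ler_pM ?mulr_ge0 ?ler_wpM2l //; lra.
have loss : n.+1%:R * p ^+ n * x <= n%:R * C * lam.
  apply: (@le_trans _ _ x); first by rewrite ler_piMl //; case/andP: x01.
  by apply: le_trans xlam _; rewrite -mulrA ler_wpM2l // ler_peMl //; lra.
have := ler_wpM2l (ltW p0) loss; rewrite -natr1 in bern *; lra.
Qed.

Lemma disjoint_blocks (T : finType) (k s : nat) : (k * s <= #|T|)%N ->
  exists2 S : 'I_k -> {set T}, forall i, #|S i| = s &
    forall i j, i != j -> [disjoint S i & S j].
Proof.
(* [mxvec_index] numbers the pairs (i, j) injectively below k s, and [enum_val] turns numbers into
   elements. *)
move=> ks; pose e (i : 'I_k) (j : 'I_s) : T := enum_val (widen_ord ks (mxvec_index i j)).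
have e_inj i i' j j' : e i j = e i' j' -> i = i' /\ j = j'.
  move/enum_val_inj/(congr1 val) => /= /val_inj eq_ij.
  by case: (enum_rank_inj eq_ij).
exists (fun i => [set e i j | j : 'I_s]) => [i|i i' ii'].
  by rewrite card_imset ?card_ord // => j j' /e_inj[].
apply/pred0P => v /=; apply/negP => /andP[/imsetP[j _ ->] /imsetP[j' _ /e_inj[eq_i]]].
by rewrite eq_i eqxx in ii'.
Qed.

Lemma conv_hull_mono (R : realType) n (A B : set 'rV[R]_n) :
  (A `<=` B)%classic -> (conv_hull A `<=` conv_hull B)%classic.
Proof. by move=> AB y Ay C [convC BC]; apply: Ay; split=> // z /AB/BC. Qed.

(** * Regular complexes and the overlap bound *)

Section Regular.
Variables (R : realType) (n : nat) (V : finType) (X : {set {set V}}) (K : nat).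
Hypothesis complexX : simplicial_complex X.
Hypothesis pureX : pure X n.
Hypothesis regX : regular X n K.

Local Notation m := (simplex_mass R X n).

Lemma weight_set0 : weight X n finset.set0 = (n.+1`! * #|faces X n.+1|)%N.
Proof.
rewrite /weight cards0 subn0; congr (_ * _)%N; apply: eq_card => s.
by rewrite !inE sub0set andbT.
Qed.

Lemma weight_vertex (v : vertex X) : weight X n [set val v] = (n`! * K)%N.
Proof.
rewrite /weight cards1 subn1 /=; congr (_ * _)%N; rewrite -(regX v).
by apply: eq_card => s; rewrite !inE sub1set.
Qed.

(** Regularity gives all vertices the same mass, so at the empty simplex weighted proportions are
    plain proportions. *)
Lemma sum_vertices (F : V -> R) :
  \sum_(v | v \notin (finset.set0 : {set V})) m (v |: finset.set0) * F v =
  (n`! * K)%:R * \sum_(v : vertex X) F (val v).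
Proof.
rewrite mulr_sumr.
under [RHS]eq_bigr => v _ do rewrite -(weight_vertex v).
rewrite -(big_sub [pred v | [set v] \in X] (fun v => m [set v] * F v)).
rewrite big_mkcond [RHS]big_mkcond; apply: eq_bigr => v _ /=.
rewrite !inE finset.setU0; case: ifP => // /negbT Xv.
by rewrite /simplex_mass weight_eq0 // mul0r.
Qed.

Lemma weight_set0_regular :
  weight X n finset.set0 = (n`! * K * #|{: vertex X}|)%N.
Proof.
apply/eqP; rewrite -(eqr_nat R) -(sum_weight X) ?cards0 // natr_sum.
have /= := sum_vertices (fun=> 1); under eq_bigr do rewrite mulr1.
by rewrite sumr_const => ->; rewrite -natrM eqxx.
Qed.

Lemma facet_exists : exists s, s \in faces X n.+1.
Proof. by have [s Xs _] := pureX complexX.1; exists s. Qed.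

Lemma gt_n_vertices : (n < #|{: vertex X}|)%N.
Proof.
have [s Fs] := facet_exists; have /andP[Xs /eqP cs] : (s \in X) && (#|s| == n.+1).
  by move: Fs; rewrite inE.
rewrite -cs; have sub v : v \in s -> [set v] \in X.
  by move=> vs; apply: complexX.2 Xs _; rewrite sub1set.
rewrite -[X in (_ <= X)%N](card_imset (mem {: vertex X}) val_inj).
apply: subset_leq_card; apply/fintype.subsetP => v vs.
by apply/imsetP; exists (exist _ v (sub v vs)).
Qed.

Lemma K_gt0 : (0 < K)%N.
Proof.
have := weight_gt0 pureX complexX.1; rewrite weight_set0_regular.
by rewrite !muln_gt0 => /andP[/andP[]].
Qed.

Variable lam : R.
Hypothesis lam_ge0 : 0 <= lam.
Hypothesis n_gt0 : (0 < n)%N.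
Hypothesis gap : forall t, t \in X -> (#|t| < n)%N -> walk_gap X n lam t.

(* The walk has trace 0 and the eigenvalue 1; concretely, test the spectral
   gap on the indicator of a vertex and on its centering. *)
Lemma lam_ge_invN : #|{: vertex X}|%:R^-1 <= lam.
Proof.
have N0 := leq_ltn_trans (leq0n _) gt_n_vertices.
set N := #|{: vertex X}| in N0 *.
have [v0 _] := card_gt0P N0.
pose M : R := (n`! * K)%:R.
have M0 : 0 < M by rewrite ltr0n muln_gt0 fact_gt0 K_gt0.
have NR : 0 < N%:R :> R by rewrite ltr0n.
pose h v : R := (v == val v0)%:R; pose g v := h v - N%:R^-1.
have sumh : \sum_(v : vertex X) h (val v) = 1.
  rewrite (bigD1 v0) //= /h eqxx big1 ?addr0 // => v.
  by rewrite -val_eqE => /negbTE ->.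
have hh v : h v ^+ 2 = h v by rewrite /h; case: (v == _); rewrite ?expr1n ?expr0n.
have g0 : \sum_(v | v \notin (finset.set0 : {set V})) m (v |: finset.set0) * g v = 0.
  rewrite sum_vertices sumrB sumh sumr_const -/N -(mulr_natr (N%:R^-1)).
  by rewrite mulVf ?gt_eqF // subrr mulr0.
have /gap gap0 := complexX.1; move: gap0; rewrite cards0 => /(_ n_gt0 h _ g0).
rewrite sum_vertices big_split /=.
under [X in X + _]eq_bigr do rewrite hh.
have -> : \sum_(v : vertex X) g (val v) ^+ 2 = 1 - N%:R^-1.
  transitivity (\sum_(v : vertex X) (h (val v) - 2 * N%:R^-1 * h (val v) + N%:R^-1 ^+ 2)).
    by apply: eq_bigr => v _; rewrite /g -{2}hh; ring.
  rewrite big_split sumrB /= -mulr_sumr sumh sumr_const -/N -(mulr_natr (N%:R^-1 ^+ 2)).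
  by field; rewrite gt_eqF.
rewrite sumh (bigD1 (val v0)) ?inE //= /h eqxx mul1r [X in _ + X]big1 ?addr0; last first.
  by move=> v /andP[_ /negbTE ->]; rewrite mul0r.
rewrite (eq_bigr (fun u => m (u |: (val v0 |: finset.set0)) * - N%:R^-1)); last first.
  by move=> u; rewrite !inE orbF => /negbTE uv; rewrite /g /h uv sub0r.
rewrite -mulr_suml -natr_sum sum_weight ?cardsU1 ?inE ?cards0 //=.
rewrite finset.setU0 weight_vertex -/M mulrN normrN ger0_norm; last first.
  by rewrite mulr_ge0 ?invr_ge0 ?(ltW M0).
have Ninv : 0 < N%:R^-1 :> R by rewrite invr_gt0.
(* The gap reads M / N <= (lam / 2) M (2 - 1 / N), and the right side is at most lam M. *)
move=> le; rewrite -(ler_pM2l M0); apply: le_trans le _.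
have := mulr_ge0 (mulr_ge0 lam_ge0 (ltW M0)) (ltW Ninv); lra.
Qed.

Variable P : R.
Hypothesis pachP : pach_constant n P.

Theorem regular_overlap :
  n`!%:R * P * ((P / n.+1%:R) ^+ n - n.+1%:R * mixing_constant R n * lam)
    <= overlap R n X.
Proof.
set N := #|{: vertex X}|.
have [f ->] := overlap_min R n X.
have overlap_ge y : overlap_at f y <= sup (range (overlap_at f)).
  apply: ub_le_sup; last by exists y.
  exists 1 => _ [z _ <-]; rewrite /overlap_at.
  have [->|F0] := eqVneq (#|faces X n.+1|) 0%N; first by rewrite invr0 mulr0.
  rewrite ler_pdivrMr ?mul1r ?ltr0n ?lt0n // ler_nat.
  by apply: subset_leq_card; apply/fintype.subsetP => s; rewrite inE => /andP[].
have sN : (n.+1 * (N %/ n.+1) <= N)%N by rewrite mulnC leq_divM.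
have [S cS dS] := disjoint_blocks sN.
have [U US [y yU]] := pach_family pachP n_gt0 f S.
have [i0 _ min0] := @arg_minnP _ ord0 xpredT (fun i => #|U i|) isT.
pose u := #|U i0|.
(* The sets are shrunk to the smallest size [u], so that all densities at the empty simplex equal u
   / N. *)
have /choice[W WP] i : exists W : {set vertex X}, W \subset U i /\ #|W| = u.
  exists [set v in take u (enum (U i))]; split.
    by apply/fintype.subsetP => v; rewrite inE => /mem_take; rewrite mem_enum.
  rewrite cardsE (card_uniqP _) ?take_uniq ?enum_uniq // size_takel // -cardE.
  exact: min0.
pose E i : {set V} := [set val v | v in W i].
pose Es := [seq E i | i <- enum 'I_n.+1].
have szE : size Es = n.+1 by rewrite size_map size_enum_ord.
have disjE : pairwise (fun A B : {set V} => [disjoint A & B]) Es.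
  rewrite pairwise_map; apply: sub_pairwise (_ : pairwise (fun i j => i != j) _).
    move=> i j /dS dij; apply/pred0P => v; apply/negP => /= /andP[].
    case/imsetP=> x xi ->; case/imsetP=> z zj /val_inj xz.
    have xS : x \in S i by apply: (fintype.subsetP (US i).1); apply: (fintype.subsetP (WP i).1).
    have zS : z \in S j by apply: (fintype.subsetP (US j).1); apply: (fintype.subsetP (WP j).1).
    by move: (disjointFr dij xS); rewrite xz zS.
  by rewrite -uniq_pairwise enum_uniq.
pose M : R := (n`! * K)%:R; pose F : R := #|faces X n.+1|%:R.
have M0 : 0 < M by rewrite ltr0n muln_gt0 fact_gt0 K_gt0.
have N0 : 0 < N%:R :> R by rewrite ltr0n (leq_ltn_trans _ gt_n_vertices).
have F0 : 0 < F.
  by have [s Fs] := facet_exists; rewrite ltr0n; apply/card_gt0P; exists s.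
have mMN : m finset.set0 = M * N%:R by rewrite /simplex_mass weight_set0_regular natrM.
have mF : m finset.set0 = n.+1`!%:R * F by rewrite /simplex_mass weight_set0 natrM.
have mass i : link_mass R X n finset.set0 (E i) = M * u%:R.
  rewrite /link_mass (sum_vertices (fun v => (v \in E i)%:R)); congr (_ * _).
  under eq_bigr do rewrite (mem_imset (mem (W i)) _ val_inj).
  rewrite -natr_sum -(WP i).2 -sum1_card [in RHS]big_mkcond; congr (_%:R).
have mixE : `|(transversals X n finset.set0 Es)%:R
     - m finset.set0 * (u%:R / N%:R) ^+ n.+1|
     <= lam * n%:R / 2 * (n.+1%:R * (M * u%:R)).
  have := mixing complexX lam_ge0 gap complexX.1 (Us := Es).
  rewrite cards0 szE => /(_ erefl) /=.
  rewrite !big_map -enumT !big_enum /=.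
  under eq_bigr do rewrite mass.
  under [\sum_(_ in _) _]eq_bigr do rewrite mass.
  rewrite prodr_const sumr_const card_ord -[_ *+ n.+1]mulr_natl -/(m _) mMN.
  by rewrite -mulf_div mulfV ?gt_eqF // mul1r.
have hit := transversals_hit X (n := n) (t := finset.set0) disjE.
rewrite cards0 szE in hit; have {}hit := hit erefl.
have cover : (transversals X n finset.set0 Es)%:R / F <= overlap_at f y.
  rewrite /overlap_at ler_pM2r ?invr_gt0 // ler_nat; apply: leq_trans hit _.
  apply: subset_leq_card; apply/fintype.subsetP => s; rewrite !inE.
  case/and3P=> -> _ /allP hitE; apply/asboolP.
  have /choice[x xP] i : exists x : vertex X, x \in W i /\ val x \in s.
    have /set0Pn[v] : E i :&: (s :\: finset.set0) != finset.set0.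
      by apply: hitE; apply: map_f; rewrite mem_enum.
    by rewrite finset.setD0 => /setIP[/imsetP[x xW ->] xs]; exists x.
  (* A facet that meets every [E i] contains the vertices of a transversal, and the hull of their
     images already contains [y]. *)
  apply: (@conv_hull_mono _ _ (range (fun i => f (x i)))).
    by move=> _ [i _ <-]; exists (x i) => //=; apply: (xP i).2.
  by apply: yU => i; apply: (fintype.subsetP (WP i).1); apply: (xP i).1.
apply: (@overlap_arith R n N u P lam) => //.
- exact: gt_n_vertices.
- by have [] := pachP.
- exact: pach_constant_le1 pachP.
- exact: lam_ge_invN.
- exact: mixing_constant_ge.
- by have := (US i0).2; rewrite cS.
- apply: le_trans (overlap_ge y); apply: le_trans cover.
  by rewrite divr_ge0 // ltW.
apply: le_trans (overlap_ge y); apply: le_trans cover.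
rewrite ler_pdivlMr // mulrAC -mF.
have -> : m finset.set0 * ((u%:R / N%:R) ^+ n.+1 - lam * (n%:R * n.+1%:R / 2) * (u%:R / N%:R)) =
  m finset.set0 * (u%:R / N%:R) ^+ n.+1 - lam * n%:R / 2 * (n.+1%:R * (M * u%:R)).
  by rewrite mulrBr; congr (_ - _); rewrite mMN; field; rewrite gt_eqF.
move: mixE => /ler_normlP[]; lra.
Qed.

End Regular.

Local Open Scope classical_set_scope.

Theorem theorem8p4 (R : realType) (n : nat) (V : finType) (X : {set {set V}})
    (K : nat) (lam P : R) :
  (1 <= n)%N ->
  simplicial_complex X -> pure X n -> connected_links X n ->
  regular X n K ->
  0 < lam -> lam < 1 ->
  (forall k : nat, (k <= n - 1)%N -> forall t : {set V}, t \in faces X k ->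
     walk_spectrum R X n t `<=` `[- lam, lam] `|` [set 1]) ->
  pach_constant n P ->
  n`!%:R * P * ((P / n.+1%:R) ^+ n - n.+1%:R * mixing_constant R n * lam)
    <= overlap R n X.
Proof.
move=> n_gt0 complexX pureX connX regX lam_gt0 _ specX pachP.
have lam_ge0 := ltW lam_gt0.
apply: (regular_overlap complexX pureX regX lam_ge0 n_gt0 _ pachP) => t Xt tn.
apply: link_walk_gap => //; first exact: connX.
(* Faces are indexed by cardinality, so the hypothesis on X(k - 1) is used with k = [#|t|]. *)
have tF : t \in faces X #|t| by rewrite inE Xt eqxx.
have tn1 : (#|t| <= n - 1)%N by rewrite leq_subRL // add1n.
move=> a /(specX _ tn1 t tF)[] /=; last by right.
by rewrite in_itv /= => aI; left; rewrite ler_norml.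
Qed.
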